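(* Temporal atomic query answering is undecidable (in combined complexity) both for $\mathcal{TEL}^{\bigcirc}$-TBoxes and for $\mathcal{TEL}^{\bigcirc}_{\mathit{future}}$-TBoxes extended with rigid concept names.
   Context: A $\mathcal{TEL}^{\bigcirc}$-TBox is a finite set of concept inclusions $A\sqsubseteq\bigcirc^nB$, $A\sqcap A'\sqsubseteq B$, $\exists r.A\sqsubseteq B$, $A\sqsubseteq\exists r.B$ ($A,A',B$ concept names, $r$ a role name, rigid or local, $n\in\mathbb{Z}$); a $\mathcal{TEL}^{\bigcirc}_{\mathit{future}}$-TBox additionally requires $n\ge0$. Semantics: an interpretation is a family $(\mathcal{I}_i)_{i\in\mathbb{Z}}$ of classical DL interpretations over a common domain containing the individual names (interpreted as themselves), rigid role names interpreted identically at all $i$; $(\bigcirc^nA)^{i}=A^{i+n}$, $\sqcap$ is intersection, $(\exists r.A)^i=\{d\mid\exists e\in A^i,(d,e)\in r^i\}$; $C\sqsubseteq D$ holds if $C^i\subseteq D^i$ for all $i$. Rigid concept names are concept names required to have the same interpretation at all time points $i$. An ABox is a finite set of facts $A(a,n)$, $r(a,b,n)$ ($n\in\mathbb{Z}$), satisfied when $a\in A^{n}$, resp. $(a,b)\in r^{n}$. Temporal atomic query answering (TAQA): given a TBox $\mathcal{T}$, an ABox $\mathcal{A}$ and a fact $A(a,n)$, decide whether $(\mathcal{T},\mathcal{A})\models A(a,n)$, i.e. $A(a,n)$ holds in every interpretation satisfying $\mathcal{T}$ and $\mathcal{A}$. Combined complexity: input size $|\mathcal{T}|+|\mathcal{A}|+|A(a,n)|$.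 *)

(* Defs.v *)
From mathcomp Require Import all_boot all_order all_algebra.

Set Implicit Arguments.
Unset Strict Implicit.
Unset Printing Implicit Defensive.

Import Order.TTheory GRing.Theory Num.Theory.
Local Open Scope ring_scope.

(** * Temporal EL *)

(* Concept names and role names alike come in two disjoint countably infinite
   supplies; only the [Rigid] ones have a time-independent interpretation. *)
Inductive name := Local of nat | Rigid of nat.

Definition is_local (x : name) : bool := if x is Local _ then true else false.

Inductive concept :=
| Atom of name
| Next of int & name
| And of name & name
| Ex of name & name.

Inductive inclusion :=
| SubNext of name & int & name    (* A ⊑ ○^n B *)
| SubAnd of name & name & name    (* A ⊓ A' ⊑ B *)
| SubExL of name & name & name    (* ∃r.A ⊑ B, arguments r, A, B *)
| SubExR of name & name & name.   (* A ⊑ ∃r.B, arguments A, r, B *)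

Definition lhs (c : inclusion) : concept :=
  match c with
  | SubNext A _ _ => Atom A
  | SubAnd A A' _ => And A A'
  | SubExL r A _ => Ex r A
  | SubExR A _ _ => Atom A
  end.

Definition rhs (c : inclusion) : concept :=
  match c with
  | SubNext _ n B => Next n B
  | SubAnd _ _ B => Atom B
  | SubExL _ _ B => Atom B
  | SubExR _ r B => Ex r B
  end.

Definition tbox := seq inclusion.

(* Individual names are natural numbers. *)
Record cfact := CFact { cf_concept : name; cf_ind : nat; cf_time : int }.

Inductive fact :=
| ConceptFact of cfact
| RoleFact of name & nat & nat & int.

Definition abox := seq fact.

(* [ind] is an embedding: the domain contains the individual names, each of
   which denotes itself (so distinct names denote distinct elements). *)
Record interp := Interp {
  dom : Type;
  ind : nat -> dom;
  cext : int -> name -> dom -> Prop;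
  rext : int -> name -> dom -> dom -> Prop;
  ind_inj : injective ind;
  cext_rigid : forall k i j d, cext i (Rigid k) d <-> cext j (Rigid k) d;
  rext_rigid : forall k i j d e, rext i (Rigid k) d e <-> rext j (Rigid k) d e
}.

Definition ext (I : interp) (i : int) (C : concept) (d : dom I) : Prop :=
  match C with
  | Atom A => cext i A d
  | Next n A => cext (i + n) A d
  | And A A' => cext i A d /\ cext i A' d
  | Ex r A => exists e : dom I, cext i A e /\ rext i r d e
  end.

Definition sat_inclusion (I : interp) (c : inclusion) : Prop :=
  forall (i : int) (d : dom I), ext i (lhs c) d -> ext i (rhs c) d.

Definition sat_cfact (I : interp) (f : cfact) : Prop :=
  cext (cf_time f) (cf_concept f) (ind I (cf_ind f)).

Definition sat_fact (I : interp) (f : fact) : Prop :=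
  match f with
  | ConceptFact g => sat_cfact I g
  | RoleFact r a b n => rext n r (ind I a) (ind I b)
  end.

Definition sat_tbox (I : interp) (T : tbox) : Prop :=
  foldr (fun c P => sat_inclusion I c /\ P) True T.

Definition sat_abox (I : interp) (A : abox) : Prop :=
  foldr (fun f P => sat_fact I f /\ P) True A.

(** * Temporal atomic query answering *)

Record instance := Instance {
  inst_tbox : tbox;
  inst_abox : abox;
  inst_query : cfact
}.

Definition entailed (x : instance) : Prop :=
  forall I : interp,
    sat_tbox I (inst_tbox x) -> sat_abox I (inst_abox x) ->
    sat_cfact I (inst_query x).

Definition future_inclusion (c : inclusion) : bool :=
  if c is SubNext _ n _ then 0 <= n else true.

Definition local_concepts (c : inclusion) : bool :=
  match c with
  | SubNext A _ B => is_local A && is_local B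
  | SubAnd A A' B => [&& is_local A, is_local A' & is_local B]
  | SubExL _ A B => is_local A && is_local B
  | SubExR A _ B => is_local A && is_local B
  end.

Definition local_fact (f : fact) : bool :=
  if f is ConceptFact g then is_local (cf_concept g) else true.

(* No rigid concept names; role names may be rigid or local. *)
Definition TEL_instance (x : instance) : bool :=
  [&& all local_concepts (inst_tbox x), all local_fact (inst_abox x)
    & is_local (cf_concept (inst_query x))].

(* Concept names and role names may both be rigid or local. *)
Definition TEL_future_rigid_instance (x : instance) : bool :=
  all future_inclusion (inst_tbox x).

(** * Encoding of instances *)

(* [CodeSeq.code] is the computable bijection from [seq nat] to [nat] given by
   code [::] = 0 and code (n :: s) = 2 ^ n * (2 * code s + 1). *)
Definition code_int (n : int) : nat :=
  match n with Posz k => k.*2 | Negz k => k.*2.+1 end.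

Definition code_name (x : name) : nat :=
  match x with Local k => k.*2 | Rigid k => k.*2.+1 end.

Definition code_inclusion (c : inclusion) : nat :=
  match c with
  | SubNext A n B =>
      CodeSeq.code [:: 0%N; code_name A; code_int n; code_name B]
  | SubAnd A A' B =>
      CodeSeq.code [:: 1%N; code_name A; code_name A'; code_name B]
  | SubExL r A B =>
      CodeSeq.code [:: 2%N; code_name r; code_name A; code_name B]
  | SubExR A r B =>
      CodeSeq.code [:: 3%N; code_name A; code_name r; code_name B]
  end.

Definition code_cfact (f : cfact) : nat :=
  CodeSeq.code [:: code_name (cf_concept f); cf_ind f; code_int (cf_time f)].

Definition code_fact (f : fact) : nat :=
  match f with
  | ConceptFact g => CodeSeq.code [:: 0%N; code_cfact g]
  | RoleFact r a b n => CodeSeq.code [:: 1%N; code_name r; a; b; code_int n]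
  end.

Definition code_instance (x : instance) : nat :=
  CodeSeq.code [:: CodeSeq.code (map code_inclusion (inst_tbox x));
                   CodeSeq.code (map code_fact (inst_abox x));
                   code_cfact (inst_query x)].

Lemma code_int_inj : injective code_int.
Proof.
move=> [m|m] [n|n] /= e; have /= := congr1 odd e; rewrite ?odd_double //= => _.
  by rewrite (double_inj e).
by case: e => /double_inj ->.
Qed.

Lemma code_name_inj : injective code_name.
Proof.
move=> [m|m] [n|n] /= e; have /= := congr1 odd e; rewrite ?odd_double //= => _.
  by rewrite (double_inj e).
by case: e => /double_inj ->.
Qed.

Lemma code_inclusion_inj : injective code_inclusion.
Proof.
by move=> [a b c|a b c|a b c|a b c] [a' b' c'|a' b' c'|a' b' c'|a' b' c'];
   move/(can_inj CodeSeq.codeK) => // -[];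
   do ?[move/code_name_inj-> | move/code_int_inj->].
Qed.

Lemma code_cfact_inj : injective code_cfact.
Proof.
move=> [a b c] [a' b' c'] /(can_inj CodeSeq.codeK) /= [].
by move/code_name_inj-> => -> /code_int_inj->.
Qed.

Lemma code_fact_inj : injective code_fact.
Proof.
move=> [f|r a b n] [f'|r' a' b' n'] /(can_inj CodeSeq.codeK) //= [].
  by move/code_cfact_inj->.
by move/code_name_inj-> => -> -> /code_int_inj->.
Qed.

Lemma code_instance_inj : injective code_instance.
Proof.
move=> [T A f] [T' A' f'] /(can_inj CodeSeq.codeK) /= [].
move/(can_inj CodeSeq.codeK)/(inj_map code_inclusion_inj)->.
by move/(can_inj CodeSeq.codeK)/(inj_map code_fact_inj)-> => /code_cfact_inj->.
Qed.

(** * Decidability *)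

(* Minsky register machines with unboundedly many registers; they compute
   exactly the partial recursive functions. *)
Inductive instr :=
| Inc of nat           (* increment a register, go to the next instruction *)
| Dec of nat & nat.    (* [Dec r l]: if register r is 0 go to l, otherwise
                          decrement it and go to the next instruction *)

Definition program := seq instr.

Record config := Config { pc : nat; regs : nat -> nat }.

Definition upd (f : nat -> nat) (r v : nat) : nat -> nat :=
  fun s => if s == r then v else f s.

Definition step (p : program) (c : config) : config :=
  if (pc c < size p)%N then
    match nth (Inc 0) p (pc c) with
    | Inc r => Config (pc c).+1 (upd (regs c) r (regs c r).+1)
    | Dec r l =>
        if regs c r == 0%N then Config l (regs c)
        else Config (pc c).+1 (upd (regs c) r (regs c r).-1)
    end
  else c.

Definition initial (n : nat) : config :=
  Config 0 (fun r => if r == 0%N then n else 0%N).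

(* A program halts when its program counter leaves the program. Input and
   output are in register 0. *)
Definition computes (p : program) (n v : nat) : Prop :=
  exists k : nat, let c := iter k (step p) (initial n) in
    (size p <= pc c)%N /\ regs c 0%N = v.

(* The decision problem "P x?" for inputs x of the syntactic class K, presented
   by the encoding [code]. *)
Definition decidable_on (X : Type) (code : X -> nat) (K : pred X)
    (P : X -> Prop) : Prop :=
  exists p : program, forall x : X, K x ->
    (P x -> computes p (code x) 1) /\ (~ P x -> computes p (code x) 0).

Definition TAQA_undecidable (K : pred instance) : Prop :=
  ~ decidable_on code_instance K entailed.

(* Main.v *)
(* Start an element at time t when the concept zeroV holds there. The times at
   which it then satisfies a concept, relative to t, form a set of integers not
   depending on the element, and A ⊑ ∃r.zeroV, ∃r.B ⊑ C with r rigid says that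
   C contains the sumset A + B. So a TBox is a system of inclusions between sets
   of numbers built with sums and intersections, and its entailments are the
   least solution. Following Jeż's unary conjunctive grammar for the powers
   of 4, the constraint (A + B) ∩ (A' + B') ⊆ C defines the powers of 2 by their
   exponent modulo m and then the numbers (2 ^ j - 1) * 2 ^ i. A configuration
   of a register machine is a sum of powers of 4 ("tokens") with exponents in
   distinct residue classes; moving a token up by one period adds
   (2 ^ m - 1) * 2 ^ i, and uniqueness of base-4 expansions ensures that the sum
   is again a configuration only for the right i. Registers are differences of
   two token values, so that all numbers ever needed are non-negative. That the
   halting state holds at some time is propagated to time 0 by ○^-1, or by a
   rigid concept.
   Deciding entailment is then refuted by diagonalization: the machine that on
   input n builds the instance asking whether the machine with TBox coded by n
   halts on n, runs the alleged decision procedure on it and does the opposite. *)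
From HB Require Import structures.
From Stdlib Require Import FunctionalExtensionality.
Require Import Defs.
From mathcomp Require Import all_boot all_order all_algebra zify.

Set Implicit Arguments.
Unset Strict Implicit.
Unset Printing Implicit Defensive.

Import GRing.Theory.

(** * Register machine programs *)

Definition reaches (p : program) (c c' : config) : Prop :=
  exists k, iter k (step p) c = c'.

Lemma reaches_refl p c : reaches p c c.
Proof. by exists 0. Qed.

Lemma reaches_trans p c1 c2 c3 :
  reaches p c1 c2 -> reaches p c2 c3 -> reaches p c1 c3.
Proof. by case=> i <- [j <-]; exists (j + i); rewrite iterD. Qed.

Lemma reaches_step p c c' : reaches p (step p c) c' -> reaches p c c'.
Proof. by case=> k <-; exists k.+1; rewrite iterSr. Qed.

Definition reloc (o : nat) (i : instr) : instr :=
  if i is Dec r l then Dec r (o + l) else i.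

Definition shift_config (o : nat) (c : config) : config :=
  Config (o + pc c) (regs c).

Lemma map_reloc0 p : map (reloc 0) p = p.
Proof. by elim: p => //= -[r|r l] p ->. Qed.

Lemma step_embed p pre post c : pc c < size p ->
  step (pre ++ map (reloc (size pre)) p ++ post) (shift_config (size pre) c) =
  shift_config (size pre) (step p c).
Proof.
case: c => q f /= lt_q; rewrite /step /= !size_cat size_map ltn_add2l lt_q.
rewrite ltn_addr // nth_cat ltnNge leq_addr /= addKn nth_cat size_map lt_q.
rewrite (nth_map (Inc 0)) //; case: (nth _ _ _) => [r|r l] /=.
  by rewrite /shift_config /= addnS.
by case: ifP => _; rewrite /shift_config /= ?addnS.
Qed.

Lemma reaches_embed p pre post c c' : reaches p c c' ->
  reaches (pre ++ map (reloc (size pre)) p ++ post)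
    (shift_config (size pre) c) (shift_config (size pre) c').
Proof.
case=> k; elim: k c => [|k IHk] c; first by move=> /= <-; exact: reaches_refl.
rewrite iterSr => /IHk; have [lt_c|ge_c] := ltnP (pc c) (size p).
  by rewrite -(step_embed pre post) // => /reaches_step.
by rewrite /step ltnNge ge_c.
Qed.

Definition runs (p : program) (f g : nat -> nat) : Prop :=
  reaches p (Config 0 f) (Config (size p) g).

Definition seqp (p q : program) : program := p ++ map (reloc (size p)) q.

Lemma size_seqp p q : size (seqp p q) = size p + size q.
Proof. by rewrite size_cat size_map. Qed.

Lemma reaches_seqp p q f g c : runs p f g -> reaches q (Config 0 g) c ->
  reaches (seqp p q) (Config 0 f) (shift_config (size p) c).
Proof.
move=> /(reaches_embed [::] (map (reloc (size p)) q)).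
rewrite /= map_reloc0 => /reaches_trans pq /(reaches_embed p [::]).
by rewrite cats0 /shift_config /= addn0; exact: pq.
Qed.

Lemma runs_seqp p q f g h : runs p f g -> runs q g h -> runs (seqp p q) f h.
Proof. by rewrite {3}/runs size_seqp => pfg; exact: (reaches_seqp pfg). Qed.

(* [z] is a register holding 0, which makes [Dec z 0] an unconditional jump. *)
Definition loopp (z r : nat) (p : program) : program :=
  Dec r (size p).+2 :: map (reloc 1) p ++ [:: Dec z 0].

Lemma size_loopp z r p : size (loopp z r p) = (size p).+2.
Proof. by rewrite /= size_cat size_map addn1. Qed.

Lemma runs_loopp0 z r p f : f r = 0 -> runs (loopp z r p) f f.
Proof. by move=> fr; rewrite /runs size_loopp; exists 1; rewrite /= /step /= fr. Qed.

Lemma runs_looppS z r p f g h :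
  0 < f r -> runs p (upd f r (f r).-1) g -> g z = 0 ->
  runs (loopp z r p) g h -> runs (loopp z r p) f h.
Proof.
move=> fr pfg gz run; apply: reaches_step.
rewrite /step /= -[_ == 0]negbK -lt0n fr /=.
have /= := reaches_embed [:: Dec r (size p).+2] [:: Dec z 0] pfg.
move/reaches_trans; apply; apply: reaches_step.
rewrite /step /shift_config /= size_cat size_map addn1 add1n !ltnS leqnn.
by rewrite nth_cat size_map ltnn subnn /= gz; move: run;
  rewrite /runs size_loopp.
Qed.

Lemma updE f r v s : upd f r v s = if s == r then v else f s.
Proof. by []. Qed.

Lemma runs_incs k b f : runs (nseq k (Inc b)) f (upd f b (f b + k)).
Proof.
suff it i : i <= k -> iter i (step (nseq k (Inc b))) (Config 0 f) =
                      Config i (upd f b (f b + i)).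
  by exists k; rewrite it // size_nseq.
elim: i => [|i IHi] lt_ik; first by congr Config;
  apply: functional_extensionality
  => s; rewrite updE addn0; case: eqP => [->|].
rewrite iterS IHi 1?ltnW // /step size_nseq lt_ik nth_nseq lt_ik /=.
congr Config; apply: functional_extensionality => s.
by rewrite !updE eqxx; case: eqP => // _; rewrite addnS.
Qed.

Lemma runs_eq p f g h : runs p f g -> g =1 h -> runs p f h.
Proof. by move=> + /functional_extensionality <-. Qed.

Lemma upd_same f r v : f r = v -> upd f r v = f.
Proof.
move=> <-; apply: functional_extensionality => s.
by rewrite updE; case: eqP => [->|].
Qed.

(** * Register arithmetic: multiplication, shifts and the encoder *)

Section Arithmetic.

Variable z : nat.

Definition movep (k a b : nat) : program := loopp z a (nseq k (Inc b)).

Lemma runs_movep k a b f : f z = 0 -> a != z -> b != z -> a != b ->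
  runs (movep k a b) f (upd (upd f a 0) b (f b + k * f a)).
Proof.
move=> + az bz ab; move fa: (f a) => n; elim: n f fa => [|n IHn] f fa fz.
  by rewrite muln0 addn0 (upd_same fa) upd_same //; exact: runs_loopp0.
apply: runs_looppS; first by rewrite fa.
- exact: runs_incs.
- by rewrite !updE (eq_sym z) (negPf bz) (eq_sym z) (negPf az).
rewrite fa /=; set g := upd _ _ _.
have -> : upd (upd f a 0) b (f b + k * n.+1) = upd (upd g a 0) b (g b + k * n).
  apply: functional_extensionality => s; rewrite /g !updE eqxx (eq_sym b).
  rewrite (negPf ab); case: eqP => // _; first by rewrite mulnS addnA.
  by case: eqP.
apply: IHn; first by rewrite /g !updE (negPf ab) eqxx.
by rewrite /g !updE (eq_sym z) (negPf bz) (eq_sym z) (negPf az).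
Qed.

Definition shiftp (x y w : nat) : program :=
  loopp z x (seqp (movep 2 y w) (movep 1 w y)).

Lemma runs_shiftp x y w f : uniq [:: z; x; y; w] -> f z = 0 -> f w = 0 ->
  runs (shiftp x y w) f (upd (upd f x 0) y (2 ^ f x * f y)).
Proof.
rewrite /= !inE !negb_or -!andbA => /and5P[zx zy zw xy /and3P[xw yw _]].
move fx: (f x) => n; elim: n f fx => [|n IHn] f fx fz fw.
  by rewrite mul1n (upd_same fx) upd_same //; exact: runs_loopp0.
pose g := upd (upd f x n) y (2 * f y).
apply: (@runs_looppS _ _ _ _ g); first by rewrite fx.
- apply: runs_seqp.
    by apply: runs_movep; rewrite ?updE ?fz ?(negPf zx) // eq_sym.
  apply: runs_eq; first apply: runs_movep.
  + by rewrite !updE (negPf zw) (negPf zy) (negPf zx).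
  + by rewrite eq_sym.
  + by rewrite eq_sym.
  + by rewrite eq_sym.
  move=> s; rewrite /g fx !updE !eqxx (negPf yw) !(eq_sym y) !(eq_sym w).
  rewrite (negPf xy) (negPf xw) fw mul1n !add0n.
  case: eqP => // _; case: (eqVneq s w) => // ->.
  by rewrite eq_sym (negPf xw).
- by rewrite /g !updE (negPf zy) (negPf zx).
have -> : upd (upd f x 0) y (2 ^ n.+1 * f y) = upd (upd g x 0) y (2 ^ n * g y).
  apply: functional_extensionality => s; rewrite /g !updE eqxx.
  case: eqP => // _; first by rewrite expnS; lia.
  by case: eqP.
apply: IHn; rewrite /g !updE ?eqxx.
- by rewrite (negPf xy).
- by rewrite (negPf zy) (negPf zx).
- by rewrite eq_sym (negPf yw) eq_sym (negPf xw).
Qed.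

End Arithmetic.

(** Register 2 holds the argument, 3 accumulates, 4 is scratch and 5 stays 0 for the jumps. Register
    1 is left alone: it keeps the input for the last stage of [encodep]. *)
Definition affp (a b : nat) : program :=
  seqp (nseq a (Inc 3)) (seqp (shiftp 5 2 3 4)
    (seqp (nseq b (Inc 3)) (movep 5 1 3 2))).

Lemma runs_affp a b f : f 3 = 0 -> f 4 = 0 -> f 5 = 0 ->
  runs (affp a b) f (upd f 2 (2 ^ f 2 * a + b)).
Proof.
move=> f3 f4 f5; apply: runs_seqp; first exact: runs_incs.
apply: runs_seqp; first by apply: runs_shiftp; rewrite ?updE.
apply: runs_seqp; first exact: runs_incs.
apply: runs_eq; first by apply: runs_movep; rewrite ?updE.
move=> s; rewrite !updE /= f3 add0n mul1n add0n.
by case: s => [|[|[|[|s]]]] //=; lia.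
Qed.

Definition initregs (n : nat) : nat -> nat := fun r => if r == 0 then n else 0.

Definition splitp (m : nat) : program :=
  loopp 5 0 (seqp (nseq 1 (Inc 1)) (nseq m (Inc 2))).

Lemma runs_splitp m n :
  runs (splitp m) (initregs n) (upd (upd (initregs 0) 1 n) 2 (m * n)).
Proof.
suff run k f : f 0 = k -> f 5 = 0 ->
    runs (splitp m) f (upd (upd (upd f 0 0) 1 (f 1 + k)) 2 (f 2 + m * k)).
  apply: runs_eq (run n _ _ _) _ => // s; rewrite !updE /initregs.
  by case: s.
elim: k f => [|k IHk] f f0 f5.
  rewrite muln0 !addn0 [upd (upd _ _ _) _ _]upd_same ?updE //.
  by rewrite !upd_same //; exact: runs_loopp0.
pose g := upd (upd (upd f 0 k) 1 (f 1).+1) 2 (f 2 + m).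
apply: (@runs_looppS _ _ _ _ g); first by rewrite f0.
- apply: runs_seqp; first exact: runs_incs.
  by apply: runs_eq; first exact: runs_incs; move=> s;
    rewrite /g f0 !updE addn1.
- by rewrite /g !updE.
apply: runs_eq; first by apply: IHk; rewrite /g !updE.
move=> s; rewrite /g !updE /=; case: eqP => _; first by rewrite mulnS addnA.
by case: eqP => _; [rewrite addSnnS | case: eqP].
Qed.

(** With all but one entry of a list fixed, [CodeSeq.code] of the list is affine in the power of 2
    whose exponent is the varying entry. Iterating such maps follows an entry up through nested
    codes. *)
Fixpoint affs (s : seq (nat * nat)) (x : nat) : nat :=
  if s is (a, b) :: s' then affs s' (2 ^ x * a + b) else x.

Fixpoint affsp (s : seq (nat * nat)) : program :=
  if s is (a, b) :: s' then seqp (affp a b) (affsp s') else [::].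

Lemma runs_affsp s f : f 3 = 0 -> f 4 = 0 -> f 5 = 0 ->
  runs (affsp s) f (upd f 2 (affs s (f 2))).
Proof.
elim: s f => [|[a b] s IHs] f f3 f4 f5 /=.
  by rewrite upd_same //; exact: reaches_refl.
apply: runs_seqp; first exact: runs_affp.
apply: runs_eq; first by apply: IHs; rewrite updE.
by move=> t; rewrite !updE /=; case: eqP.
Qed.

Definition encodep (m : nat) (s : seq (nat * nat)) : program :=
  seqp (splitp m) (seqp (affsp s) (seqp (shiftp 5 1 2 4) (movep 5 1 2 0))).

Lemma runs_encodep m s n :
  runs (encodep m s) (initregs n) (initregs (2 ^ n * affs s (m * n))).
Proof.
apply: runs_seqp; first exact: runs_splitp.
apply: runs_seqp; first by apply: runs_affsp; rewrite updE.
apply: runs_seqp; first by apply: runs_shiftp; rewrite ?updE.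
apply: runs_eq; first by apply: runs_movep; rewrite ?updE.
move=> t; rewrite !updE /= mul1n add0n /initregs.
by case: (eqVneq t 0) => // t0; do 3?case: eqP.
Qed.

(** A jump may leave [p] far beyond its end. Cutting the targets down to [size p] makes every
    halting run end exactly there, as [seqp] requires. *)
Definition truncp (p : program) : program :=
  map (fun i => if i is Dec r l then Dec r (minn l (size p)) else i) p.

Lemma reaches_truncp p k c :
  let c' := iter k (step p) c in
  reaches (truncp p) (Config (minn (pc c) (size p)) (regs c))
    (Config (minn (pc c') (size p)) (regs c')).
Proof.
elim: k c => [|k IHk] c /=; first exact: reaches_refl.
rewrite -iterS iterSr; have [lt_c|ge_c] := ltnP (pc c) (size p); last first.
  have -> : step p c = c by rewrite /step ltnNge ge_c.
  by have := IHk c; rewrite (minn_idPr ge_c).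
apply: reaches_step; set c1 := step _ (Config _ _).
suff -> : c1 = Config (minn (pc (step p c)) (size p)) (regs (step p c)).
  exact: IHk.
rewrite /c1 /step /= size_map lt_c.
rewrite (nth_map (Inc 0)) //; case: (nth _ _ _) => [r|r l] /=.
  by rewrite (minn_idPl lt_c).
by case: ifP => _ //=; rewrite (minn_idPl lt_c).
Qed.

Lemma runs_truncp p x v : computes p x v ->
  exists2 g, runs (truncp p) (initregs x) g & g 0 = v.
Proof.
case=> k [halt v_eq]; have := reaches_truncp p k (initial x).
rewrite /= (minn_idPr halt) min0n => run;
  exists (regs (iter k (step p) (initial x))) => //.
by rewrite /runs size_map.
Qed.

(** * Halting and the diagonal machine *)

Definition halts (p : program) (n : nat) : Prop :=
  exists k, size p <= pc (iter k (step p) (initial n)).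

(* If register 0 holds 1, the second instruction jumps to itself forever. *)
Definition flipp : program := [:: Dec 0 2; Dec 0 1].

Definition diagp (c d : program) : program := seqp c (seqp (truncp d) flipp).

Lemma diagp_halts c d n x : runs c (initregs n) (initregs x) ->
  computes d x 0 -> halts (diagp c d) n.
Proof.
move=> run_c /runs_truncp[g run_d g0].
have run : runs (diagp c d) (initregs n) g.
  apply: runs_seqp run_c _; apply: runs_seqp run_d _.
  by exists 1; rewrite /= /step /= g0.
by case: run => k run; exists k; rewrite run.
Qed.

Lemma iter_halted p c k : size p <= pc c -> iter k (step p) c = c.
Proof.
by move=> halt; elim: k => //= k ->; rewrite /step ltnNge halt.
Qed.

Lemma stuck_not_halts p n c : reaches p (initial n) c ->
  pc c < size p -> step p c = c -> ~ halts p n.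
Proof.
move=> [j run] lt_c stuck [k halt].
have: iter (j + k) (step p) (initial n) = c.
  by rewrite addnC iterD run; elim: k {halt} => //= k ->.
by rewrite iterD iter_halted // => eq_c; rewrite eq_c leqNgt lt_c in halt.
Qed.

Lemma diagp_diverges c d n x : runs c (initregs n) (initregs x) ->
  computes d x 1 -> ~ halts (diagp c d) n.
Proof.
move=> run_c /runs_truncp[g run_d g0].
pose e := Config 1 (upd g 0 0).
have run_e : reaches flipp (Config 0 g) e by exists 1; rewrite /= /step /= g0.
(* A fixed point of the second program remains one after relocation behind the first. *)
have stuck p q c0 : pc c0 < size q -> step q c0 = c0 ->
    step (seqp p q) (shift_config (size p) c0) = shift_config (size p) c0.
  by move=> lt_c eq_c; have := step_embed p [::] lt_c; rewrite cats0 eq_c.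
apply: stuck_not_halts (reaches_seqp run_c (reaches_seqp run_d run_e)) _ _.
  by rewrite !size_seqp /=; lia.
by apply: (stuck _ _ _); [rewrite size_seqp /=; lia | apply: (stuck _ _ _)].
Qed.

(** The TBox fixes the number of tokens, so the simulated machine needs a bound on its registers. *)
Definition uses_below (b : nat) (i : instr) : bool :=
  match i with Inc r => r < b | Dec r _ => r < b end.

Lemma uses_below_reloc b o p :
  all (uses_below b) (map (reloc o) p) = all (uses_below b) p.
Proof. by rewrite all_map; apply: eq_all => -[]. Qed.

Lemma uses_below_seqp b p q : all (uses_below b) (seqp p q) =
  all (uses_below b) p && all (uses_below b) q.
Proof. by rewrite all_cat uses_below_reloc. Qed.

Lemma uses_below_loopp b z r p : all (uses_below b) (loopp z r p) =
  [&& r < b, z < b & all (uses_below b) p].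
Proof. by rewrite /= all_cat uses_below_reloc /= andbT (andbC (z < b)). Qed.

Lemma uses_below_nseq b k r : r < b -> all (uses_below b) (nseq k (Inc r)).
Proof. by move=> lt_r; rewrite all_nseq /= lt_r orbT. Qed.

Lemma uses_below_exists p : exists b, all (uses_below b) p.
Proof.
elim: p => [|i p [b pb]]; first by exists 0.
pose r := match i with Inc r => r | Dec r _ => r end.
exists (maxn r.+1 b); apply/andP; split.
  by rewrite /r; case: i {r} => [r|r l] /=; rewrite leq_max ltnSn.
by apply: sub_all pb => -[s|s l] /= lt_s; rewrite leq_max lt_s orbT.
Qed.

Lemma uses_below_diagp b m s d : 5 < b -> all (uses_below b) d ->
  all (uses_below b) (diagp (encodep m s) d).
Proof.
move=> b5 db; have inb k r : r <= 5 -> all (uses_below b) (nseq k (Inc r)).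
  by move=> le_r; apply/uses_below_nseq/(leq_ltn_trans le_r).
have affb : all (uses_below b) (affsp s).
  elim: s => //= -[u v] s IHs; rewrite !(uses_below_seqp, uses_below_loopp) IHs.
  by rewrite !inb //= !(leq_ltn_trans _ b5).
rewrite !(uses_below_seqp, uses_below_loopp) affb !inb //=.
rewrite !(leq_ltn_trans _ b5) // /truncp all_map /= andbT.
by apply: sub_all db => -[].
Qed.

(** * Base expansions *)

Lemma sum_expn_shift b s :
  \sum_(x <- s) b ^ x =
  count_mem 0 s + b * \sum_(x <- [seq y.-1 | y <- s & 0 < y]) b ^ x.
Proof.
elim: s => [|[|x] s IHs]; first by rewrite !big_nil muln0.
  by rewrite big_cons IHs expn0 /= addnA.
by rewrite big_cons IHs /= big_cons mulnDr -expnS; lia.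
Qed.

Lemma count_mem_shift s x :
  count_mem x [seq y.-1 | y <- s & 0 < y] = count_mem x.+1 s.
Proof. by elim: s => [|[|y] s IHs] //=; rewrite IHs. Qed.

(** Multiplicities below b are base-b digits. The remainder modulo b gives the multiplicity of
    exponent 0; dividing by b lowers the other exponents, and the induction is on a bound for
    them. *)
Lemma sum_expn_inj b s t : 1 < b ->
  (forall x, count_mem x s < b) -> (forall x, count_mem x t < b) ->
  \sum_(x <- s) b ^ x = \sum_(x <- t) b ^ x -> perm_eq s t.
Proof.
move=> b_gt1; have b_gt0 : 0 < b by apply: ltnW.
have bounded (s0 : seq nat) : exists n, all (ltn^~ n) s0.
  exists (\sum_(x <- s0) x).+1; apply/allP => x x_s0 /=.
  by rewrite ltnS (big_rem x) //= leq_addr.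
have [n] := bounded (s ++ t); rewrite all_cat => /andP[].
elim: n s t => [|n IHn] s t lt_s lt_t cs ct eq_st.
  by case: s lt_s {cs eq_st} => //; case: t lt_t {ct}.
have lt_shift r : all (ltn^~ n.+1) r ->
    all (ltn^~ n) [seq y.-1 | y <- r & 0 < y].
  move=> /allP lt_r; apply/allP => x /mapP[y]; rewrite mem_filter.
  by move=> /andP[y0 /lt_r /= lt_y] -> /=; lia.
move: eq_st; rewrite sum_expn_shift [RHS]sum_expn_shift => eq_st.
have eq0 : count_mem 0 s = count_mem 0 t.
  by have := congr1 (modn^~ b) eq_st;
    rewrite ![_ + b * _]addnC !(mulnC b) !modnMDl !modn_small.
move: eq_st; rewrite eq0 => /addnI/eqP; rewrite eqn_pmul2l // => /eqP.
move=> /IHn perm; apply/allP => -[|x] _ /=; first by rewrite eq0.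
rewrite -!count_mem_shift; apply/eqP/permP/perm; try exact: lt_shift.
- by move=> y; rewrite count_mem_shift.
- by move=> y; rewrite count_mem_shift.
Qed.

Lemma sum_exp2_inj s t : uniq s -> uniq t ->
  \sum_(x <- s) 2 ^ x = \sum_(x <- t) 2 ^ x -> perm_eq s t.
Proof.
move=> us ut; apply: sum_expn_inj => // x; rewrite count_uniq_mem //.
  by case: (x \in s).
by case: (x \in t).
Qed.

Lemma sum_exp2_iota i j : \sum_(x <- iota i j) 2 ^ x = (2 ^ j).-1 * 2 ^ i.
Proof.
elim: j => [|j IHj]; first by rewrite big_nil.
have j0 := expn_gt0 2 j.
rewrite -addn1 iotaD big_cat IHj /= big_seq1 !expnD expn1.
nia.
Qed.

Lemma eqn_mod_near m i j : i = j %[mod m] -> i < j + m -> j < i + m -> i = j.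
Proof.
wlog le_ij : i j / i <= j => [W ij lt1 lt2|].
  by case: (leqP i j) => [/W|/ltnW/W e]; [apply | apply/esym/e].
move/esym/eqP; rewrite eqn_mod_dvd // => /dvdnP[q].
by case: q => [|q]; lia.
Qed.

Lemma succ_neq_mod m i : 1 < m -> i = i.+1 %[mod m] -> False.
Proof. by move=> m1 /eqn_mod_near; lia. Qed.

(** A sum of two powers of 2 has two binary ones, or a single one after a carry. *)
Lemma size_sum_two_powers a b s : uniq s ->
  2 ^ a + 2 ^ b = \sum_(x <- s) 2 ^ x -> size s <= 2.
Proof.
move=> us; have [->|ab] := eqVneq a b => eq_s.
  rewrite -(@perm_size _ [:: b.+1] s) //; apply: sum_exp2_inj => //.
  by rewrite big_seq1 -eq_s expnS; lia.
rewrite -(@perm_size _ [:: a; b] s) //; apply: sum_exp2_inj => //.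
  by rewrite /= inE ab.
by rewrite big_cons big_seq1.
Qed.

(** If c and d differ, the congruence also excludes c = d + 1, so the right side has the three
    binary ones c, d, d + 1: too many for two powers. The next two lemmas count ones in the same
    way. *)
Lemma two_powers_eq_pow_three m a b c d : 1 < m -> c = d %[mod m] ->
  2 ^ a + 2 ^ b = 2 ^ c + 3 * 2 ^ d -> c = d.
Proof.
move=> m1 cd sum; apply/eqP/negP => /negP c_d.
have /size_sum_two_powers: uniq [:: c; d; d.+1]; last first.
  by move=> /(_ a b); rewrite !big_cons big_nil expnS /= => W;
    have := W ltac:(lia).
have n1 : c != d.+1.
  by apply/eqP=> e; apply: (succ_neq_mod m1 (i := d)); rewrite -cd e.
by rewrite /= !inE; lia.
Qed.

Lemma two_powers_eq_three_three m a b c d : 1 < m -> c = d %[mod m] ->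
  2 ^ a + 2 ^ b = 3 * 2 ^ c + 3 * 2 ^ d -> c = d.
Proof.
move=> m1 cd sum; apply/eqP/negP => /negP c_d.
have /size_sum_two_powers: uniq [:: c; c.+1; d; d.+1]; last first.
  by move=> /(_ a b); rewrite !big_cons big_nil !expnS /= => W;
    have := W ltac:(lia).
have n1 : c != d.+1.
  by apply/eqP=> e; apply: (succ_neq_mod m1 (i := d)); rewrite -cd e.
have n2 : c.+1 != d.
  by apply/eqP=> e; apply: (succ_neq_mod m1 (i := c)); rewrite e.
by rewrite /= !inE; lia.
Qed.

Lemma two_powers_eq_three_pow m a b c d : 1 < m -> d = c.+1 %[mod m] ->
  2 ^ a + 2 ^ b = 3 * 2 ^ c + 2 ^ d -> d = c.+1.
Proof.
move=> m1 dc sum; apply/eqP/negP => /negP d_c.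
have /size_sum_two_powers: uniq [:: c; c.+1; d]; last first.
  by move=> /(_ a b); rewrite !big_cons big_nil !expnS /= => W;
    have := W ltac:(lia).
have n1 : c != d by apply/eqP=> e; apply: (succ_neq_mod m1 (i := c));
  rewrite -dc e.
by rewrite /= !inE; lia.
Qed.

(** In binary, (2^j - 1) * 2^i is a block of j ones starting at i. The congruences keep each single
    power outside its block, so both sides list the same set of ones, which determines i' and b. *)
Lemma block_extension m j i a i' b : 1 < j < m ->
  a = j + i %[mod m] -> i' = i.+1 %[mod m] -> b = i %[mod m] ->
  (2 ^ j).-1 * 2 ^ i + 2 ^ a = (2 ^ j).-1 * 2 ^ i' + 2 ^ b ->
  (2 ^ j).-1 * 2 ^ i + 2 ^ a = (2 ^ j.+1).-1 * 2 ^ i.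
Proof.
move=> /andP[j1 jm] ai i'i bi sum.
have a_notin : a \notin iota i j.
  rewrite mem_iota; apply/negP => /andP[le_a lt_a].
  have := eqn_mod_near ai; clear -le_a lt_a jm; lia.
have b_notin : b \notin iota i' j.
  rewrite mem_iota; apply/negP => /andP[le_b lt_b].
  suff: b.+1 = i' by clear -le_b; lia.
  apply: (@eqn_mod_near m); try by clear -le_b lt_b jm; lia.
  by rewrite i'i -[b.+1]add1n -[i.+1]add1n -modnDmr bi modnDmr.
have /perm_mem eq_mem : perm_eq (a :: iota i j) (b :: iota i' j).
  apply: sum_exp2_inj; rewrite /= ?a_notin ?b_notin ?iota_uniq //.
  by rewrite !big_cons !sum_exp2_iota addnC sum addnC.
(* Position i + 1 lies in the left block since j > 1. It is not b, as b is congruent to i, so it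
   lies in the right block, whose start is then close enough to be pinned down by its residue. *)
have i'E : i' = i.+1.
  have := eq_mem i.+1; rewrite !inE !mem_iota.
  have -> : i <= i.+1 < i + j by clear -j1; lia.
  rewrite orbT => /esym/orP[/eqP e|le_i'].
    by case: (@succ_neq_mod m i); [exact: ltn_trans jm | rewrite -bi e].
  by apply: (eqn_mod_near i'i); clear -le_i' jm; lia.
have bE : b = i.
  have := eq_mem i; rewrite !inE !mem_iota i'E ltnn /= orbF.
  have -> : i <= i < i + j by clear -j1; lia.
  by rewrite orbT => /esym/eqP.
rewrite sum i'E bE !expnS; have := expn_gt0 2 j; clear; nia.
Qed.

(** * Sumset constraints as TBoxes *)

HB.instance Definition _ := Equality.copy inclusion (inj_type code_inclusion_inj).

Lemma sat_tboxP I (T : tbox) :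
  sat_tbox I T <-> forall c, c \in T -> sat_inclusion I c.
Proof.
elim: T => [|c T [IH1 IH2]] /=; first by split.
split=> [[satc satT] c'|sat].
  by rewrite inE => /predU1P[->|]; [exact: satc | exact: IH1].
split; first by apply: sat; rewrite mem_head.
by apply: IH2 => c' Tc'; apply: sat; rewrite inE Tc' orbT.
Qed.

Definition var := seq nat.

(* Variables denote sets of natural numbers, [inl (n, C)] the constraint
   n ∈ C and [inr (A, B, A', B', C)] the constraint (A + B) ∩ (A' + B') ⊆ C. *)
Definition rule := (nat * var + var * var * var * var * var)%type.

Definition Const n C : rule := inl (n, C).
Definition Meet A B A' B' C : rule := inr (A, B, A', B', C).

Definition sat_rule (X : var -> nat -> Prop) (r : rule) : Prop :=
  match r with
  | inl (n, C) => X C n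
  | inr (A, B, A', B', C) => forall a b a' b', X A a -> X B b ->
      X A' a' -> X B' b' -> a + b = a' + b' -> X C (a + b)
  end.

Definition zeroV : var := [:: 0].

(* Even and odd codes keep the auxiliary names for sumsets apart. *)
Definition conc (A : var) : name := Local (CodeSeq.code A).*2.
Definition sumc (A B : var) : name :=
  Local (CodeSeq.code [:: CodeSeq.code A; CodeSeq.code B]).*2.+1.
Definition role (A : var) : name := Rigid (CodeSeq.code A).

(* An element that satisfies [zeroV] at time t satisfies [A] at the times t + x
   with x in the set A. *)
Definition sum_incls (A B : var) : tbox :=
  [:: SubExR (conc A) (role A) (conc zeroV);
      SubExL (role A) (conc B) (sumc A B)].

Definition rule_incls (r : rule) : tbox :=
  match r with
  | inl (n, C) => [:: SubNext (conc zeroV) (Posz n) (conc C)]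
  | inr (A, B, A', B', C) => sum_incls A B ++ sum_incls A' B' ++
      [:: SubAnd (sumc A B) (sumc A' B') (conc C)]
  end.

Definition rules_tbox (rs : seq rule) : tbox := flatten (map rule_incls rs).

(** * From a solution of the constraints to a model of the TBox *)

Section Model.

Variables (X : var -> nat -> Prop).

Definition model_set (k : nat) (x : nat) : Prop :=
  if odd k then
    if CodeSeq.decode k./2 is [:: a; b] then
      exists y z, [/\ x = y + z, X (CodeSeq.decode a) y & X (CodeSeq.decode b) z]
    else False
  else X (CodeSeq.decode k./2) x.

Definition model_cext (i : int) (A : name) (d : int) : Prop :=
  if A is Local k then exists2 x : nat, i = (d + x%:Z)%R & model_set k x
  else False.

Definition model_rext (i : int) (r : name) (d e : int) : Prop :=
  if r is Rigid k then
    exists2 x : nat, e = (d + x%:Z)%R & X (CodeSeq.decode k) x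
  else False.

Lemma Posz_inj : injective Posz. Proof. by move=> ? ? []. Qed.

(* Element d is a copy of the solution [X] whose origin is time d. *)
Definition model : interp :=
  @Interp int Posz model_cext model_rext Posz_inj
    (fun _ _ _ _ => iff_refl _) (fun _ _ _ _ _ => iff_refl _).

Lemma model_conc i A d :
  model_cext i (conc A) d <-> exists2 x : nat, i = (d + x%:Z)%R & X A x.
Proof. by rewrite /= /model_set odd_double doubleK CodeSeq.codeK. Qed.

Lemma model_sumc i A B d : model_cext i (sumc A B) d <->
  exists y z : nat, [/\ i = (d + (y + z)%:Z)%R, X A y & X B z].
Proof.
rewrite /sumc; move code_k: (CodeSeq.code _) => k.
rewrite /= /model_set /= odd_double /= uphalf_double -code_k !CodeSeq.codeK.
split=> [[x -> [y [z [->]]]]|[y [z [-> Ay Bz]]]].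
  by exists y, z.
by exists (y + z) => //; exists y, z.
Qed.

Lemma model_role i A d e :
  model_rext i (role A) d e <-> exists2 x : nat, e = (d + x%:Z)%R & X A x.
Proof. by rewrite /= CodeSeq.codeK. Qed.

Hypothesis X_zero : forall x, X zeroV x <-> x = 0.

Lemma model_sum_incls A B c : c \in sum_incls A B -> sat_inclusion model c.
Proof.
rewrite !inE => /orP[]/eqP-> i d.
  move=> /model_conc[x -> Ax]; exists (d + x%:Z)%R.
  by split; [apply/model_conc; exists 0; rewrite ?addr0 ?X_zero |
             apply/model_role; exists x].
move=> [e [/model_conc[y -> By] dre]].
have [x -> Ax] := iffLR (model_role (e + y)%R A d e) dre.
by apply/model_sumc; exists x, y; rewrite PoszD addrA.
Qed.

Lemma model_rules rs : (forall r, r \in rs -> sat_rule X r) ->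
  sat_tbox model (rules_tbox rs).
Proof.
move=> satX; apply/sat_tboxP => c /flatten_mapP[r /satX].
case: r => [[n C]|[[[[A B] A'] B'] C]] sat_r; rewrite /rule_incls.
  rewrite inE => /eqP-> i d /model_conc[x -> /X_zero->].
  by apply/model_conc; exists n; rewrite ?addr0.
rewrite !mem_cat => /or3P[/model_sum_incls//|/model_sum_incls//|].
rewrite inE => /eqP-> i d [/model_sumc[a [b [-> Aa Bb]]]].
move=> /model_sumc[a' [b' [/addrI[eq_ab] A'a' B'b']]].
by apply/model_conc; exists (a + b) => //; apply: sat_r Aa Bb A'a' B'b' eq_ab.
Qed.

End Model.

(** * From the constraints to consequences of the TBox *)

Section Derivation.

Variables (rs : seq rule) (I : interp).
Hypothesis satI : sat_tbox I (rules_tbox rs).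

Definition holds (i : int) (d : dom I) (A : var) (x : nat) : Prop :=
  cext (i + x%:Z)%R (conc A) d.

(** Membership at every copy of the origin. The second summand of a sumset must be of this kind,
    being evaluated at an unknown successor; a machine state is only known at the individual of the
    ABox, hence the separate [holds]. *)
Definition valid (A : var) (x : nat) : Prop :=
  forall i d, holds i d zeroV 0 -> holds i d A x.

Lemma sat_rule_incls r c : r \in rs -> c \in rule_incls r -> sat_inclusion I c.
Proof.
by move=> rs_r r_c; apply: (iffLR (sat_tboxP _ _) satI); apply/flatten_mapP;
  exists r.
Qed.

Lemma valid_zero : valid zeroV 0. Proof. by []. Qed.

Lemma valid_const n C : Const n C \in rs -> valid C n.
Proof.
move=> /sat_rule_incls/(_ (mem_head _ _)) sat i d.
by rewrite /holds addr0 => /sat.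
Qed.

Lemma holds_sum i d A B a b :
  (forall c, c \in sum_incls A B -> sat_inclusion I c) ->
  holds i d A a -> valid B b -> cext (i + (a + b)%:Z)%R (sumc A B) d.
Proof.
move=> sat /(sat _ (mem_head _ _))[e /= [e0 dre]] /(_ (i + a%:Z)%R e).
rewrite /holds addr0 => /(_ e0) Be.
apply: (sat (SubExL (role A) (conc B) (sumc A B)));
  first by rewrite !inE eqxx orbT.
(* The edge was created at time i + a; rigidity makes it available at time i + a + b. *)
by exists e; split; [rewrite PoszD addrA | exact: (rext_rigid _ _ _ _ _).1 dre].
Qed.

Lemma holds_meet i d A B A' B' C a b a' b' : Meet A B A' B' C \in rs ->
  holds i d A a -> valid B b -> holds i d A' a' -> valid B' b' ->
  a + b = a' + b' -> holds i d C (a + b).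
Proof.
move=> /sat_rule_incls sat Aa Bb A'a' B'b' eq_ab.
apply: (sat (SubAnd (sumc A B) (sumc A' B') (conc C))).
  by rewrite /rule_incls !mem_cat !inE eqxx !orbT.
split=> /=; last rewrite eq_ab; apply: holds_sum => // c c_in; apply: sat.
  by rewrite /rule_incls mem_cat c_in.
by rewrite /rule_incls !mem_cat c_in orbT.
Qed.

Lemma valid_meet A B A' B' C a b a' b' : Meet A B A' B' C \in rs ->
  valid A a -> valid B b -> valid A' a' -> valid B' b' ->
  a + b = a' + b' -> valid C (a + b).
Proof.
move=> rs_r Aa Bb A'a' B'b' eq_ab i d zero.
by apply: holds_meet rs_r _ Bb _ B'b' eq_ab; [exact: Aa | exact: A'a'].
Qed.

End Derivation.

(** * Constraints simulating a register machine *)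

(** The first entry separates the families of variables; [sem] below gives the intended sets. *)
Definition blockV (m j k : nat) : var := [:: 2; j; k %% m].
Definition fiveV (m k : nat) : var := [:: 3; k %% m].
Definition pairV (r : nat) : var := [:: 4; r].
Definition chainV (r i : nat) : var := [:: 5; r; i].
Definition geV (r : nat) : var := [:: 6; r].
Definition stateV (q : nat) : var := [:: 7; q].

Section Rules.

Variables (p : program) (M : nat).

(** There are K tokens, two per register. Since 4^K = 2^m, m is the period of the tokens in binary
    exponents. *)
Let K := M.*2.
Let m := K.*2.
Let block := blockV m.
Let five := fiveV m.
(** Index M is not a register, so this chain tests none and contains every configuration code. *)
Let validV := chainV M M.

Definition moveR (A : var) (s : nat) (V B : var) : rule :=
  Meet A (block m s.*2) V zeroV B.

(** The identities behind the three families are 2^(i+1) + 2^(i+1) = 2^i + 3 * 2^i, then 2^(i+1) +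
    2^(i+2) = 3 * 2^i + 3 * 2^i, and block extension by a one: above the block from i, or below the
    block from i + 1. *)
Definition block_rules : seq rule :=
  [:: Const 1 (block 1 0); Const 2 (block 1 1); Const 3 (block 2 0)] ++
  [seq Meet (block 1 k.+1) (block 1 k.+1) (block 1 k) (block 2 k)
         (block 1 k.+2) | k <- iota 0 m] ++
  [seq Meet (block 1 k.+1) (block 1 k.+2) (block 2 k) (block 2 k)
         (block 2 k.+1) | k <- iota 0 m] ++
  [seq Meet (block j k) (block 1 (j + k)) (block j k.+1) (block 1 k)
         (block j.+1 k) | j <- iota 2 (m - 2), k <- iota 0 m].

(** A [Meet] of a sum with itself is a plain sumset. Tokens 2r and 2r+1 of equal value add up to 5 *
    2^e with e in class 4r, and 5 * 2^e arises as 2^e + 2^(e+2) = 3 * 2^e + 2^(e+1). A chain appends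
    the registers one by one, forcing equality at register r. [geV] starts from equality and is
    closed under raising token 2r. *)
Definition test_rules : seq rule :=
  [seq Meet (block 1 k) (block 1 k.+2) (block 2 k) (block 1 k.+1) (five k)
     | k <- iota 0 m] ++
  [seq Meet (block 1 r.*2.*2) (block 1 r.*2.*2.+2) (block 1 r.*2.*2)
         (block 1 r.*2.*2.+2) (pairV r) | r <- iota 0 M] ++
  [seq Const 0 (chainV r 0) | r <- iota 0 M.+1] ++
  [seq let D := if i == r then five i.*2.*2 else pairV i in
       Meet (chainV r i) D (chainV r i) D (chainV r i.+1)
     | r <- iota 0 M.+1, i <- iota 0 M] ++
  [seq Meet (chainV r M) zeroV (chainV r M) zeroV (geV r) | r <- iota 0 M] ++
  [seq moveR (geV r) r.*2 validV (geV r) | r <- iota 0 M].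

(** Decrementing raises the subtracted token 2r+1. Its guard [geV r] is checked after the move, so
    the register was positive before. Targets are cut to [size p] so that halting is a single
    state. *)
Definition instr_rules (q : nat) : seq rule :=
  match nth (Inc 0) p q with
  | Inc r => [:: moveR (stateV q) r.*2 validV (stateV q.+1)]
  | Dec r l =>
      [:: Meet (stateV q) zeroV (chainV r M) zeroV (stateV (minn l (size p)));
          moveR (stateV q) r.*2.+1 (geV r) (stateV q.+1)]
  end.

Definition rules : seq rule :=
  block_rules ++ test_rules ++
  flatten [seq instr_rules q | q <- iota 0 (size p)].

(* Tokens 2r and 2r+1 of [w] hold register r as the difference of their
   values. Token s with value i is 4 ^ (K * i + s). *)
Definition conf_code (n : nat) (w : nat -> nat) : nat :=
  \sum_(0 <= s < n) 4 ^ (K * w s + s).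

Definition represents (w : nat -> nat) (f : nat -> nat) : Prop :=
  forall r, r < M -> w r.*2 = w r.*2.+1 + f r.

Variable n : nat.

(** The intended solution for input [n]; that it satisfies [rules] yields the countermodel when the
    machine diverges. *)
Definition sem (A : var) (x : nat) : Prop :=
  match A with
  | [:: 0] => x = 0
  | [:: 2; j; k] => exists2 i, i = k %[mod m] & x = (2 ^ j).-1 * 2 ^ i
  | [:: 3; k] => exists2 i, i = k %[mod m] & x = 5 * 2 ^ i
  | [:: 4; r] => exists i j,
      x = 4 ^ (K * i + r.*2) + 4 ^ (K * j + r.*2.+1)
  | [:: 5; r; i] => exists2 w, (r < i -> w r.*2 = w r.*2.+1) &
      x = conf_code i.*2 w
  | [:: 6; r] => exists2 w, w r.*2.+1 <= w r.*2 & x = conf_code K w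
  | [:: 7; q] => exists k w,
      let c := iter k (step p) (initial n) in
      [/\ minn (pc c) (size p) = q, represents w (regs c) &
          x = conf_code K w]
  | _ => False
  end.

Hypothesis pM : all (uses_below M) p.
Hypothesis M_gt0 : 0 < M.

Let m_ge4 : 3 < m. Proof. by rewrite /m /K; lia. Qed.

Lemma sem_block j k x :
  sem (block j k) x <-> exists2 i, i = k %[mod m] & x = (2 ^ j).-1 * 2 ^ i.
Proof.
by split=> -[i ik ->]; exists i => //; move: ik; rewrite modn_mod.
Qed.

Lemma sem_pow k x : sem (block 1 k) x <-> exists2 i, i = k %[mod m] & x = 2 ^ i.
Proof.
by rewrite sem_block; split=> -[i ik ->]; exists i; rewrite // mul1n.
Qed.

Lemma sem_three k x :
  sem (block 2 k) x <-> exists2 i, i = k %[mod m] & x = 3 * 2 ^ i.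
Proof. by rewrite sem_block. Qed.

Lemma sem_five k x :
  sem (five k) x <-> exists2 i, i = k %[mod m] & x = 5 * 2 ^ i.
Proof.
by split=> -[i ik ->]; exists i => //; move: ik; rewrite modn_mod.
Qed.


(** * Tokens and the uniqueness of configuration codes *)

Let K_gt0 : 0 < K. Proof. by rewrite /K; lia. Qed.

(** As m = 2K, 4^(K l + s) is 2^(m l + 2s): the residue class of the exponent identifies the
    token. *)
Lemma exp2_token i s : s < K -> i = s.*2 %[mod m] ->
  exists l, 2 ^ i = 4 ^ (K * l + s).
Proof.
move=> lt_s; rewrite [s.*2 %% m]modn_small; last by rewrite /m; lia.
move=> i_s; exists (i %/ m); rewrite {1}(divn_eq i m) i_s -[4]/(2 ^ 2) -expnM.
by congr (2 ^ _); rewrite /m; lia.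
Qed.

Definition tokens (n : nat) (w : nat -> nat) : seq nat :=
  [seq K * w s + s | s <- iota 0 n].

Lemma conf_codeE k w : conf_code k w = \sum_(x <- tokens k w) 4 ^ x.
Proof. by rewrite big_map /conf_code /index_iota subn0. Qed.

Lemma token_inj i s j t : s < K -> t < K -> K * i + s = K * j + t -> i = j /\ s = t.
Proof.
move=> lt_s lt_t e; have st : s = t.
  by have := congr1 (modn^~ K) e; rewrite ![K * _]mulnC !modnMDl !modn_small.
by move: e; rewrite st => /addIn/eqP; rewrite eqn_pmul2l // => /eqP.
Qed.

Lemma tokensP w x : reflect (exists2 s, s < K & x = K * w s + s) (x \in tokens K w).
Proof.
apply: (iffP mapP) => -[s]; first by rewrite mem_iota => /= lt_s ->; exists s.
by move=> lt_s ->; exists s; rewrite ?mem_iota.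
Qed.

Lemma mem_token w i s : s < K -> K * i + s \in tokens K w -> w s = i.
Proof. by move=> lt_s /tokensP[t lt_t /token_inj[]// -> ->]. Qed.

Lemma uniq_tokens w : uniq (tokens K w).
Proof.
rewrite map_inj_in_uniq ?iota_uniq // => s t; rewrite !mem_iota => ks kt.
by case/token_inj.
Qed.

Lemma conf_code_inj w w' : conf_code K w = conf_code K w' ->
  forall s, s < K -> w s = w' s.
Proof.
rewrite !conf_codeE => /sum_expn_inj eq_t s lt_s; apply/esym/mem_token => //.
rewrite -(perm_mem (eq_t _ _ _)) //.
- by apply/tokensP; exists s.
- by move=> x; rewrite count_uniq_mem ?uniq_tokens //; case: (x \in _).
- by move=> x; rewrite count_uniq_mem ?uniq_tokens //; case: (x \in _).
Qed.

Lemma block_token i s :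
  (2 ^ m).-1 * 4 ^ (K * i + s) + 4 ^ (K * i + s) = 4 ^ (K * i.+1 + s).
Proof.
rewrite -mulSnr prednK ?expn_gt0 // /m -mul2n expnM -expnD.
by congr (4 ^ _); rewrite mulnS addnA.
Qed.

(** Adding 4^(K i + s) to both sides turns the block into the single power 4^(K (i+1) + s). Every
    exponent then occurs at most twice, so base-4 expansions are unique and K i + s must be a token
    of [w]. *)
Lemma conf_code_shift w w' s i : s < K ->
  conf_code K w + (2 ^ m).-1 * 4 ^ (K * i + s) = conf_code K w' -> w s = i.
Proof.
move=> lt_s eq_sum.
have /sum_expn_inj eq_t : \sum_(x <- K * i.+1 + s :: tokens K w) 4 ^ x =
    \sum_(x <- K * i + s :: tokens K w') 4 ^ x.
  by rewrite !big_cons -!conf_codeE -block_token -eq_sum /=; lia.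
have: K * i + s \in K * i.+1 + s :: tokens K w.
  rewrite (perm_mem (eq_t _ _ _)) ?mem_head // => x /=.
    by rewrite count_uniq_mem ?uniq_tokens //; case: eqP; case: (x \in _).
  by rewrite count_uniq_mem ?uniq_tokens //; case: eqP; case: (x \in _).
by rewrite inE => /predU1P[/token_inj[]// |/mem_token]; [lia | apply].
Qed.

Lemma conf_code_ext k w w' : (forall s, s < k -> w s = w' s) ->
  conf_code k w = conf_code k w'.
Proof. by move=> e; apply: eq_big_nat => s /andP[_ /e->]. Qed.

Lemma conf_code_upd w s : s < K ->
  conf_code K w + (2 ^ m).-1 * 4 ^ (K * w s + s) = conf_code K (upd w s (w s).+1).
Proof.
move=> lt_s; have s_in : s \in index_iota 0 K by rewrite mem_index_iota.
rewrite /conf_code (bigD1_seq s) ?iota_uniq //= [RHS](bigD1_seq s) ?iota_uniq //=.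
rewrite updE eqxx -block_token [RHS]addnAC addnAC [RHS]addnAC.
congr (_ + _); last by apply: eq_bigr => t /negPf t_s; rewrite updE t_s.
exact: addnC.
Qed.

Lemma conf_codeS i w : conf_code i.+1.*2 w = conf_code i.*2 w +
  (4 ^ (K * w i.*2 + i.*2) + 4 ^ (K * w i.*2.+1 + i.*2.+1)).
Proof. by rewrite doubleS /conf_code !big_nat_recr //= addnA. Qed.

Lemma sem_zero x : sem zeroV x <-> x = 0. Proof. by []. Qed.

(** * The intended sets satisfy every constraint *)

Definition sound (r : rule) : Prop := sat_rule sem r.

(** The guard [V] admits only configuration codes, so [conf_code_shift] forces the added block to
    sit at the current value of token [s]. *)
Lemma sound_moveR A s V B : s < K ->
  (forall x, sem A x -> exists2 w, x = conf_code K w &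
     forall w', sem V (conf_code K w') ->
       (forall t, t < K -> w' t = upd w s (w s).+1 t) ->
     sem B (conf_code K w')) ->
  (forall x, sem V x -> exists w, x = conf_code K w) ->
  sound (moveR A s V B).
Proof.
move=> lt_s AB Vw a b a' b' /AB[w -> {}AB] /sem_block[e /exp2_token e_s ->].
have [l ->] := e_s lt_s => Va' -> eq_sum; move: Va' eq_sum;
  rewrite addn0 => Va'.
have [w' eq_a'] := Vw _ Va'; rewrite eq_a' in Va' *.
move=> eq_sum; have w_s := conf_code_shift lt_s eq_sum.
rewrite eq_sum; apply: AB => // t lt_t; apply: conf_code_inj lt_t.
by rewrite -conf_code_upd // w_s.
Qed.

Lemma sem_valid x : sem validV x <-> exists w, x = conf_code K w.
Proof.
split=> [[w _ ->]|[w ->]]; first by exists w.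
by exists w => //; rewrite ltnn.
Qed.

Let m_gt1 : 1 < m. Proof. exact: leq_trans m_ge4. Qed.

Let succ_mod i j : i = j %[mod m] -> i.+1 = j.+1 %[mod m].
Proof. by move=> e; rewrite -[i.+1]addn1 -[j.+1]addn1 -modnDml e modnDml. Qed.

Lemma sound_block_rules r : r \in block_rules -> sound r.
Proof.
rewrite !mem_cat; case/or4P.
- rewrite !inE => /or3P[]/eqP->; apply/sem_block.
  + by exists 0.
  + by exists 1.
  + by exists 0.
- case/mapP=> k _ -> a b a' b' /sem_pow[x _ ->] /sem_pow[y _ ->].
  move=> /sem_pow[c ck ->] /sem_three[d dk ->] sum.
  have cd := two_powers_eq_pow_three m_gt1 (etrans ck (esym dk)) sum.
  apply/sem_pow; exists c.+2; first exact/succ_mod/succ_mod.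
  by rewrite sum cd !expnS; lia.
- case/mapP=> k _ -> a b a' b' /sem_pow[x _ ->] /sem_pow[y _ ->].
  move=> /sem_three[c ck ->] /sem_three[d dk ->] sum.
  have cd := two_powers_eq_three_three m_gt1 (etrans ck (esym dk)) sum.
  apply/sem_three; exists c.+1; first exact/succ_mod.
  by rewrite sum cd !expnS; lia.
case/allpairsP=> -[j k] [/=]; rewrite !mem_iota => j_in _ ->.
have j_lt : 1 < j < m by clear -j_in m_ge4; lia.
move=> a b a' b' /sem_block[x xk ->] /sem_pow[y yk ->].
move=> /sem_block[c ck ->] /sem_pow[d dk ->] sum.
apply/sem_block; exists x => //.
apply: block_extension j_lt _ _ _ sum.
- by rewrite yk -modnDmr -xk modnDmr.
- by rewrite ck; apply/esym/succ_mod.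
- by rewrite dk.
Qed.

Lemma conf_code_extend i w b x y :
  b = 4 ^ (K * x + i.*2) + 4 ^ (K * y + i.*2.+1) ->
  conf_code i.*2 w + b =
  conf_code i.+1.*2 (upd (upd w i.*2 x) i.*2.+1 y).
Proof.
move=> ->; rewrite conf_codeS !updE !eqxx (_ : i.*2 == i.*2.+1 = false);
  last lia.
congr (_ + _); apply: conf_code_ext => s lt_s.
by rewrite !updE !ifN_eq //; lia.
Qed.

Lemma sound_test_rules r : r \in test_rules -> sound r.
Proof.
have K4 i : i < M -> i.*2.+1 < K by rewrite /K; lia.
rewrite 4!mem_cat; case/orP; last case/or4P; last rewrite mem_cat;
  last case/orP.
- case/mapP=> k _ -> a b a' b' /sem_pow[x _ ->] /sem_pow[y _ ->].
  move=> /sem_three[c ck ->] /sem_pow[d dk ->] sum.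
  have dc : d = c.+1.
    by apply: two_powers_eq_three_pow m_gt1 _ sum; rewrite dk;
      apply/esym/succ_mod.
  apply: (iffRL (sem_five _ _)); exists c => //.
  by rewrite sum dc !expnS; lia.
- case/mapP=> i; rewrite mem_iota => /= /K4 i_M -> a b a' b'.
  move=> /sem_pow[x /(exp2_token (ltnW i_M))[l ->] ->].
  (* The class [i.*2.*2.+2] is by computation [i.*2.+1.*2], that of token 2i+1. *)
  move=> /sem_pow[y /(@exp2_token _ i.*2.+1 i_M)[j ->] ->] _ _ _.
  by exists l, j.
- case/mapP=> i _ ->; exists (fun=> 0) => //.
  by rewrite /conf_code big_geq.
- case/allpairsP=> -[i j] [/=]; rewrite !mem_iota => /= _ /K4 j_M -> a b a' b'.
  case=> w w_i -> D_b _ _ _; have [x [y [b_eq xy]]] : exists x y,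
      b = 4 ^ (K * x + j.*2) + 4 ^ (K * y + j.*2.+1) /\ (j = i -> x = y).
    case: eqP D_b => [_|ne] D_b; last first.
      by have [x [y ->]] := D_b; exists x, y; split.
    have [e /(exp2_token (ltnW j_M))[l el] ->] := iffLR (sem_five _ _) D_b.
    (* 5 * 2^e is 4^x + 4^(x+1) with x = K l + 2j: both tokens have value l. *)
    by exists l, l; split=> //; rewrite el addnS expnS; lia.
  exists (upd (upd w j.*2 x) j.*2.+1 y); last exact: conf_code_extend.
  rewrite ltnS leq_eqVlt => /predU1P[ij|lt_ij].
    by rewrite ij !updE !eqxx (_ : j.*2 == j.*2.+1 = false); [apply: xy | lia].
  by rewrite !updE !ifN_eq ?w_i //; lia.
- case/mapP=> i; rewrite mem_iota => /= i_M -> a b a' b' [w w_i ->] /sem_zero->.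
  by move=> _ _ _; exists w; rewrite ?addn0 // w_i.
case/mapP=> i; rewrite mem_iota => /= i_M ->; apply: sound_moveR.
- exact/ltnW/K4.
- move=> x [w w_i ->]; exists w => // w' _ w'_w; exists w' => //.
  rewrite !w'_w ?K4 ?(ltnW (K4 _ _)) // !updE eqxx.
  by rewrite (_ : i.*2.+1 == i.*2 = false); lia.
- by move=> x /sem_valid.
Qed.

Lemma represents_upd_even w f r : represents w f ->
  represents (upd w r.*2 (w r.*2).+1) (upd f r (f r).+1).
Proof.
move=> wf s s_M; rewrite !updE (_ : s.*2.+1 == r.*2 = false); last lia.
rewrite (inj_eq double_inj); case: eqP => [<-|_]; last exact: wf.
by rewrite addnS wf.
Qed.

Lemma represents_upd_odd w f r : represents w f -> 0 < f r ->
  represents (upd w r.*2.+1 (w r.*2.+1).+1) (upd f r (f r).-1).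
Proof.
move=> wf fr s s_M; rewrite !updE (_ : s.*2 == r.*2.+1 = false); last lia.
rewrite eqSS (inj_eq double_inj); case: eqP => [e|_]; last exact: wf.
by rewrite e in s_M *; rewrite wf //; lia.
Qed.

Lemma represents_ext w w' f : (forall s, s < K -> w' s = w s) ->
  represents w f -> represents w' f.
Proof.
move=> e wf r r_M; rewrite !e ?wf //; move: r_M; rewrite /K; lia.
Qed.

Lemma sound_instr_rules q r : q < size p -> r \in instr_rules q -> sound r.
Proof.
move=> q_p; rewrite /instr_rules.
have := all_nthP (Inc 0) pM _ q_p.
have stepE k : minn (pc (iter k (step p) (initial n))) (size p) = q ->
    pc (iter k (step p) (initial n)) = q by lia.
case nth_q: (nth (Inc 0) p q) => [s|s l] /= s_M.
  rewrite inE => /eqP->; apply: sound_moveR => [|x|x /sem_valid//].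
    by rewrite /K; lia.
  case=> k [w [/stepE pc_k w_k ->]]; exists w => // w' _ w'_w.
  exists k.+1, w'; rewrite /= /step pc_k q_p nth_q /=; split=> //; first lia.
  exact: represents_ext w'_w (represents_upd_even _ w_k).
have [K1 K2] : s.*2 < K /\ s.*2.+1 < K by rewrite /K; lia.
rewrite !inE => /orP[]/eqP->.
  move=> a b a' b' [k [w [/stepE pc_k w_k ->]]] /sem_zero-> [w' /(_ s_M) w's ->].
  (* The same number codes a configuration with equal tokens for s; by injectivity the current one
     has them too, so the register is 0. *)
  move=> /sem_zero->; rewrite !addn0 => /conf_code_inj ww'.
  have f0 : regs (iter k (step p) (initial n)) s == 0.
    have := w_k _ s_M; rewrite !ww' ?w's ?K2 // -[LHS]addn0.
    by move/addnI <-.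
  by exists k.+1, w; rewrite /= /step pc_k q_p nth_q f0.
apply: sound_moveR => [|x|x [w _ ->]]; [by rewrite /K; lia | | by exists w].
case=> k [w [/stepE pc_k w_k ->]];
  exists w => // w' [v v_s /conf_code_inj w'v] w'_w.
have f0 : 0 < regs (iter k (step p) (initial n)) s.
  move: v_s; rewrite -!w'v ?w'_w ?K1 ?K2 // !updE eqxx w_k //.
  by rewrite (_ : s.*2 == s.*2.+1 = false); lia.
exists k.+1, w'; rewrite /= /step pc_k q_p nth_q (gtn_eqF f0) /=; split=> //;
  first lia.
exact: represents_ext w'_w (represents_upd_odd w_k f0).
Qed.

Lemma sound_rules r : r \in rules -> sound r.
Proof.
rewrite mem_cat => /orP[/sound_block_rules//|].
rewrite mem_cat => /orP[/sound_test_rules//|].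
by case/flatten_mapP=> q; rewrite mem_iota => /sound_instr_rules; apply.
Qed.

(** * The constraints derive the required members and the run of the machine *)

Variable I : interp.
Hypothesis satI : sat_tbox I (rules_tbox rules).

Let valid_const := valid_const satI.
Let valid_meet := valid_meet satI.

Let block_mod j i k : i = k %[mod m] -> block j i = block j k.
Proof. by rewrite /block /blockV => ->. Qed.

Lemma mem_block_rules r : r \in block_rules -> r \in rules.
Proof. by move=> r_in; rewrite mem_cat r_in. Qed.

Lemma mem_test_rules r : r \in test_rules -> r \in rules.
Proof. by move=> r_in; rewrite mem_cat [in X in _ || X]mem_cat r_in orbT. Qed.

Let mod_in k : k %% m \in iota 0 m.
Proof. by rewrite mem_iota ltn_mod; lia. Qed.

Lemma mem_double k : Meet (block 1 k.+1) (block 1 k.+1) (block 1 k) (block 2 k)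
  (block 1 k.+2) \in rules.
Proof.
apply/mem_block_rules; rewrite 2!mem_cat; apply/or3P/Or32/mapP.
exists (k %% m); first exact: mod_in.
by congr Meet; apply: block_mod; do ?apply: succ_mod; rewrite modn_mod.
Qed.

Lemma mem_triple k : Meet (block 1 k.+1) (block 1 k.+2) (block 2 k) (block 2 k)
  (block 2 k.+1) \in rules.
Proof.
apply/mem_block_rules; rewrite 3!mem_cat; apply/or4P/Or43/mapP.
exists (k %% m); first exact: mod_in.
by congr Meet; apply: block_mod; do ?apply: succ_mod; rewrite modn_mod.
Qed.

Lemma mem_extend j k : 1 < j < m ->
  Meet (block j k) (block 1 (j + k)) (block j k.+1) (block 1 k)
    (block j.+1 k) \in rules.
Proof.
move=> j_in; apply/mem_block_rules; rewrite 3!mem_cat; apply/or4P/Or44.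
apply/allpairsP; exists (j, k %% m); split; [| exact: mod_in |].
  by rewrite mem_iota /=; clear -j_in m_ge4; lia.
by congr Meet; apply: block_mod; do ?apply: succ_mod;
  rewrite ?modn_mod ?modnDmr.
Qed.

Lemma valid_pow_three i : [/\ valid I (block 1 i) (2 ^ i),
  valid I (block 1 i.+1) (2 ^ i.+1) & valid I (block 2 i) (3 * 2 ^ i)].
Proof.
elim: i => [|i [pi pSi ti]].
  by split; apply/valid_const/mem_block_rules; rewrite mem_cat !inE eqxx ?orbT.
have pSSi : valid I (block 1 i.+2) (2 ^ i.+2).
  rewrite (_ : 2 ^ i.+2 = 2 ^ i.+1 + 2 ^ i.+1); last by rewrite !expnS; lia.
  by apply: (valid_meet (mem_double i) pSi pSi pi ti); rewrite !expnS; lia.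
split=> //; rewrite (_ : 3 * 2 ^ i.+1 = 2 ^ i.+1 + 2 ^ i.+2);
  last by rewrite !expnS; lia.
by apply: (valid_meet (mem_triple i) pSi pSSi ti ti); rewrite !expnS; lia.
Qed.

Let valid_pow i : valid I (block 1 i) (2 ^ i).
Proof. by case: (valid_pow_three i). Qed.

Let valid_three i : valid I (block 2 i) (3 * 2 ^ i).
Proof. by case: (valid_pow_three i). Qed.

Lemma valid_block j i : 1 < j <= m -> valid I (block j i) ((2 ^ j).-1 * 2 ^ i).
Proof.
(* The cases j = 0, 1 contradict the bound, and j = 2 is [valid_three]. *)
elim: j i => [|[|[|j]] IHj] i j_m //.
have j1 : 1 < j.+2 < m by clear -j_m; lia.
have j2 : 1 < j.+2 <= m by clear -j_m; lia.
have := valid_meet (mem_extend i j1) (IHj i j2) (valid_pow _) (IHj i.+1 j2) (valid_pow i).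
have pos := expn_gt0 2 j.+2.
have e1 : 2 ^ i.+1 = 2 * 2 ^ i by rewrite expnS.
have e2 : 2 ^ j.+3 = 2 * 2 ^ j.+2 by rewrite [LHS]expnS.
rewrite (expnD 2 j.+2 i) e1 e2; move: (2 ^ j.+2) (2 ^ i) pos => x y pos sum.
have -> : (2 * x).-1 * y = x.-1 * y + x * y by clear -pos; nia.
by apply: sum; clear -pos; nia.
Qed.

Lemma token_exp2 l s : 2 ^ (m * l + s.*2) = 4 ^ (K * l + s).
Proof. by rewrite -[4]/(2 ^ 2) -expnM; congr (2 ^ _); rewrite /m; lia. Qed.

Let token_mod l s : m * l + s.*2 = s.*2 %[mod m].
Proof. by rewrite mulnC modnMDl. Qed.

Lemma valid_token l s : valid I (block 1 s.*2) (4 ^ (K * l + s)).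
Proof. by rewrite -token_exp2 -(block_mod _ (token_mod l s)). Qed.

Lemma valid_move l s : valid I (block m s.*2) ((2 ^ m).-1 * 4 ^ (K * l + s)).
Proof.
rewrite -token_exp2 -(block_mod _ (token_mod l s)); apply: valid_block.
by clear -m_ge4; lia.
Qed.

Lemma valid_five l i : valid I (five i.*2.*2)
  (4 ^ (K * l + i.*2) + 4 ^ (K * l + i.*2.+1)).
Proof.
pose e := m * l + i.*2.*2.
have -> : five i.*2.*2 = five e by rewrite /five /fiveV token_mod.
have -> : 4 ^ (K * l + i.*2) + 4 ^ (K * l + i.*2.+1) = 2 ^ e + 2 ^ e.+2.
  by rewrite addnS expnS !expnS token_exp2; lia.
have e_rule : Meet (block 1 e) (block 1 e.+2) (block 2 e) (block 1 e.+1) (five e)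
    \in rules.
  apply/mem_test_rules; rewrite mem_cat; apply/orP; left; apply/mapP.
  exists (e %% m); first exact: mod_in.
  congr Meet; try by apply: block_mod; do ?apply: succ_mod; rewrite modn_mod.
  by rewrite /five /fiveV modn_mod.
by apply: (valid_meet e_rule) => //; rewrite !expnS; lia.
Qed.

Lemma valid_pair i x y : i < M ->
  valid I (pairV i) (4 ^ (K * x + i.*2) + 4 ^ (K * y + i.*2.+1)).
Proof.
move=> i_M; have vx := @valid_token x i.*2; have vy := @valid_token y i.*2.+1.
apply: (valid_meet _ vx vy vx vy) => //; apply/mem_test_rules.
rewrite 2!mem_cat; apply/or3P/Or32/mapP.
by exists i; rewrite ?mem_iota.
Qed.

Lemma valid_chain r i w : r <= M -> i <= M ->
  (r < i -> w r.*2 = w r.*2.+1) -> valid I (chainV r i) (conf_code i.*2 w).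
Proof.
move=> r_M; elim: i => [_ _|i IHi i_M w_r].
  rewrite /conf_code big_geq //; apply/valid_const/mem_test_rules.
  rewrite 3!mem_cat; apply/or4P/Or43/mapP.
  by exists r; rewrite ?mem_iota.
have IH : valid I (chainV r i) (conf_code i.*2 w).
  by apply: IHi => [|lt_ri]; [exact: ltnW | apply/w_r/ltnW].
pose D := if i == r then five i.*2.*2 else pairV i.
have vD : valid I D (4 ^ (K * w i.*2 + i.*2) + 4 ^ (K * w i.*2.+1 + i.*2.+1)).
  rewrite /D; case: eqP => [e|_]; last exact: valid_pair.
  by rewrite e -w_r ?e //; exact: valid_five.
rewrite conf_codeS; apply: (valid_meet _ IH vD IH vD) => //.
apply/mem_test_rules; rewrite 4!mem_cat; apply/orP; right; apply/or4P/Or43.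
by apply/allpairsP; exists (r, i); split; rewrite ?mem_iota.
Qed.

Lemma valid_validV w : valid I validV (conf_code K w).
Proof. by apply: valid_chain; rewrite ?ltnn. Qed.

Lemma holds_move i (d : dom I) A s V B w : moveR A s V B \in rules -> s < K ->
  holds i d A (conf_code K w) ->
  holds i d V (conf_code K (upd w s (w s).+1)) ->
  holds i d B (conf_code K (upd w s (w s).+1)).
Proof.
move=> rule_in s_K Aw Vw; rewrite -conf_code_upd //.
apply: (holds_meet satI rule_in Aw (valid_move _ _) Vw (@valid_zero I)).
by rewrite addn0 conf_code_upd.
Qed.

Lemma valid_zero_test r w : r < M -> w r.*2 = w r.*2.+1 ->
  valid I (chainV r M) (conf_code K w).
Proof. by move=> r_M w_r; apply: valid_chain => //; exact: ltnW. Qed.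

Lemma valid_ge r w : r < M -> w r.*2.+1 <= w r.*2 ->
  valid I (geV r) (conf_code K w).
Proof.
(* Induction on the difference of the two tokens, raising token 2r once per step from the equal
   configuration. *)
move=> r_M; move diff: (w r.*2 - w r.*2.+1) => d.
elim: d w diff => [|d IHd] w diff le_w.
  have := valid_zero_test r_M (w := w) ltac:(lia) => vw.
  rewrite -[conf_code _ _]addn0.
  apply: (valid_meet _ vw (@valid_zero I) vw (@valid_zero I)) => //.
  apply/mem_test_rules; rewrite 4!mem_cat; apply/orP; right; apply/or4P/Or44.
  by rewrite mem_cat; apply/orP; left; apply/mapP; exists r; rewrite ?mem_iota.
pose v := upd w r.*2 (w r.*2).-1.
have vS : v r.*2.+1 = w r.*2.+1 by rewrite /v updE; case: eqP; lia.
have v0 : v r.*2 = (w r.*2).-1 by rewrite /v updE eqxx.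
have -> : conf_code K w = conf_code K (upd v r.*2 (v r.*2).+1).
  apply: conf_code_ext => s _; rewrite v0 /v !updE.
  by case: eqP => // ->; lia.
move=> i e zero; apply: (@holds_move _ _ (geV r) _ validV);
  last exact: valid_validV.
- apply/mem_test_rules; rewrite 4!mem_cat; apply/orP; right; apply/or4P/Or44.
  by rewrite mem_cat; apply/orP; right; apply/mapP; exists r; rewrite ?mem_iota.
- by rewrite /K; lia.
by apply: (IHd v) zero; lia.
Qed.

Lemma mem_instr_rules q r : q < size p -> r \in instr_rules q -> r \in rules.
Proof.
move=> q_p r_in; rewrite mem_cat [in X in _ || X]mem_cat.
apply/or3P/Or33/flatten_mapP.
by exists q; rewrite ?mem_iota.
Qed.

(** Each machine step uses one instruction rule; its guards are valid and so hold at the element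
    that carries the state. *)
Lemma holds_run i (d : dom I) w0 k : holds i d zeroV 0 ->
  represents w0 (regs (initial n)) -> holds i d (stateV 0) (conf_code K w0) ->
  let c := iter k (step p) (initial n) in
  exists2 w, represents w (regs c) &
    holds i d (stateV (minn (pc c) (size p))) (conf_code K w).
Proof.
move=> zero w0_r state0; elim: k => [|k [w w_r state_w]] /=.
  by exists w0; rewrite ?min0n.
move: w_r state_w; move: (iter _ _ _) => -[q f] /= w_r.
have [q_p|le_q] := ltnP q (size p); last first.
  by move=> state_w; exists w;
    rewrite /step /= ltnNge le_q //= (minn_idPr le_q).
move=> state_w; rewrite /step /= q_p.
have := all_nthP (Inc 0) pM _ q_p; have := @mem_instr_rules q _ q_p.
rewrite /instr_rules; case: (nth _ _ _) => [r|r l] /= in_rules r_M.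
  have r_K : r.*2 < K by rewrite /K; lia.
  exists (upd w r.*2 (w r.*2).+1); first exact: represents_upd_even.
  rewrite (minn_idPl q_p); apply: holds_move r_K state_w _;
    last exact: valid_validV.
  by apply: in_rules; rewrite mem_head.
case: eqP => [f0|/eqP f0] /=.
  exists w => //; have vw : valid I (chainV r M) (conf_code K w).
    by apply: valid_zero_test => //; rewrite w_r // f0 addn0.
  rewrite -[conf_code _ _]addn0.
  apply: (holds_meet satI _ state_w (@valid_zero I) (vw _ _ zero) (@valid_zero I)) => //.
  by apply: in_rules; rewrite mem_head.
have r_K : r.*2.+1 < K by rewrite /K; lia.
rewrite -lt0n in f0; have w'_r := represents_upd_odd w_r f0.
exists (upd w r.*2.+1 (w r.*2.+1).+1) => //; rewrite (minn_idPl q_p).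
apply: (@holds_move _ _ _ _ (geV r) _ _ _ r_K state_w).
  by apply: in_rules; rewrite !inE eqxx orbT.
by apply: valid_ge zero => //; rewrite w'_r // leq_addr.
Qed.

End Rules.

(** * The reduction *)

Definition input_tokens (n : nat) : nat -> nat := upd (fun=> 0) 0 n.

(** Only token 0 depends on the input; the remaining tokens have value 0 and contribute this
    constant. *)
Definition input_offset (M : nat) : nat := \sum_(1 <= s < M.*2) 4 ^ s.

Lemma conf_code_input M n : 0 < M ->
  conf_code M M.*2 (input_tokens n) = 2 ^ (M.*2.*2 * n) + input_offset M.
Proof.
move=> M0; rewrite /conf_code big_ltn; last lia.
rewrite /input_tokens updE eqxx addn0 -[4]/(2 ^ 2) -expnM.
congr (2 ^ _ + _); first by lia.
apply: eq_big_nat => s /andP[s0 _].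
by rewrite updE (gtn_eqF s0) muln0.
Qed.

Lemma represents_input M n :
  represents M (input_tokens n) (regs (initial n)).
Proof. by move=> [|r] _; rewrite /input_tokens !updE. Qed.

Definition goalV : var := [:: 8].

Definition reduction (p : program) (M : nat) (goal : name) (final : tbox)
    (t : nat) : instance :=
  Instance (rules_tbox (rules p M) ++ final)
    [:: ConceptFact (CFact (conc zeroV) 0 0);
        ConceptFact (CFact (conc (stateV 0)) 0 (Posz t))]
    (CFact goal 0 0).

Lemma sat_tbox_cat I T T' : sat_tbox I (T ++ T') <-> sat_tbox I T /\ sat_tbox I T'.
Proof. by elim: T => [|c T IH] /=; [split=> // -[] | rewrite IH; tauto]. Qed.

(* Read off from the nested [CodeSeq.code] of an instance of the reduction; each
   pair accounts for one level of nesting. *)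
Definition encoding (M : nat) (goal : name) : seq (nat * nat) :=
  let e := code_name (conc (stateV 0)) in
  let k := code_fact (ConceptFact (CFact (conc zeroV) 0 0)) in
  let g := code_cfact (CFact goal 0 0) in
  [:: (2, (input_offset M).*2); (2 ^ e * 4, 2 ^ e * 3); (2, 1);
      (2 ^ k * 2, 2 ^ k); ((2 ^ g).*2.+1.*2, 1)].

Lemma code_cons x s : CodeSeq.code (x :: s) = 2 ^ x * (CodeSeq.code s).*2.+1.
Proof. by []. Qed.

Lemma code_cfact_time A t : code_cfact (CFact A 0 (Posz t)) =
  2 ^ t.*2 * (2 ^ code_name A * 4) + 2 ^ code_name A * 3.
Proof.
rewrite /code_cfact [cf_concept _]/= [cf_ind _]/= [code_int _]/= !code_cons.
rewrite /= expn0; lia.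
Qed.

Lemma code_concept_fact f : code_fact (ConceptFact f) = 2 ^ code_cfact f * 2 + 1.
Proof. rewrite /code_fact !code_cons /= expn0; lia. Qed.

Lemma code_reduction p M goal final n : 0 < M ->
  let x := reduction p M goal final (conf_code M M.*2 (input_tokens n)) in
  CodeSeq.code (map code_inclusion (inst_tbox x)) = n ->
  code_instance x = 2 ^ n * affs (encoding M goal) (M.*2.*2 * n).
Proof.
move=> M0 x code_n; rewrite /code_instance code_cons code_n; congr (2 ^ n * _).
have -> : map code_fact (inst_abox x) =
    [:: code_fact (ConceptFact (CFact (conc zeroV) 0 0));
        code_fact (ConceptFact (CFact (conc (stateV 0)) 0
          (Posz (2 ^ (M.*2.*2 * n) + input_offset M))))].
  by rewrite /x /reduction -conf_code_input.
have -> : code_cfact (inst_query x) = code_cfact (CFact goal 0 0) by [].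
rewrite [code_fact (ConceptFact (CFact (conc (stateV 0)) _ _))]code_concept_fact.
rewrite code_cfact_time /encoding.
move: (code_fact _) (code_cfact _) (code_name _) (input_offset M) => k g e c.
rewrite !code_cons [CodeSeq.code [::]]/= /affs.
rewrite (_ : 2 ^ (M.*2.*2 * n) * 2 + c.*2 = (2 ^ (M.*2.*2 * n) + c).*2);
  last lia.
move: (2 ^ (_.*2) * _ + _) => y.
have -> : 2 ^ (2 ^ y * 2 + 1) * (2 ^ k * 2) + 2 ^ k =
    2 ^ k * (2 ^ (2 ^ y * 2 + 1) * 0.*2.+1).*2.+1 by lia.
by move: (2 ^ (2 ^ k * _)) (2 ^ g) => u v; lia.
Qed.

(** * Halting amounts to entailment *)

Section Undecidability.

Variables (goal : name) (final : var -> tbox).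

Hypothesis final_model : forall X q, (forall x, ~ X q x) -> (forall x, ~ X goalV x) ->
  sat_tbox (model X) (final q) /\ ~ sat_cfact (model X) (CFact goal 0 0).

Hypothesis final_goal : forall I q x, sat_tbox I (final q) ->
  cext (Posz x) (conc q) (ind I 0) -> sat_cfact I (CFact goal 0 0).

Variables (p : program) (M n : nat).
Hypothesis p_M : all (uses_below M) p.
Hypothesis M_gt0 : 0 < M.

Let x : instance := reduction p M goal (final (stateV (size p)))
  (conf_code M M.*2 (input_tokens n)).

Lemma halts_entailed : halts p n -> entailed x.
Proof.
case=> k halt I /sat_tbox_cat[satI sat_final] [zero [state0 _]].
have zeroI : holds 0 (ind I 0) zeroV 0 by [].
have stateI : holds 0 (ind I 0) (stateV 0) (conf_code M M.*2 (input_tokens n)).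
  by rewrite /holds add0r.
have [w _] := holds_run p_M M_gt0 satI k zeroI (@represents_input M n) stateI.
rewrite (minn_idPr halt) /holds add0r => state_w.
exact: final_goal sat_final state_w.
Qed.

Lemma diverges_not_entailed : ~ halts p n -> ~ entailed x.
Proof.
move=> div ent; pose X := sem p M n.
have no_halt y : ~ X (stateV (size p)) y.
  move=> [k [w [/minn_idPr halt _ _]]]; by apply: div; exists k.
(* [sem] is [False] on [goalV], so the second premise is the identity. *)
have [sat_final] := final_model no_halt (fun _ => id); apply; apply: ent.
  apply/sat_tbox_cat; split=> //; apply: model_rules => [y|r]; first by split.
  exact: sound_rules.
split; last split=> //; apply/model_conc; first by exists 0.
exists (conf_code M M.*2 (input_tokens n)); first by rewrite add0r.
by exists 0, (input_tokens n); split;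
  [rewrite /= min0n | exact: represents_input |].
Qed.

End Undecidability.

Lemma reduction_undecidable (K : pred instance) goal (final : var -> tbox) :
  (forall p M t, K (reduction p M goal (final (stateV (size p))) t)) ->
  (forall X q, (forall x, ~ X q x) -> (forall x, ~ X goalV x) ->
     sat_tbox (model X) (final q) /\ ~ sat_cfact (model X) (CFact goal 0 0)) ->
  (forall I q x, sat_tbox I (final q) -> cext (Posz x) (conc q) (ind I 0) ->
     sat_cfact I (CFact goal 0 0)) ->
  TAQA_undecidable K.
Proof.
move=> K_reduction final_model final_goal [d dec].
(* The encoder uses registers 0 to 5. *)
have [b d_b] := uses_below_exists d; pose M := maxn b 6.
have M_gt5 : 5 < M by rewrite /M; lia.
have M_gt0 : 0 < M by apply: leq_trans M_gt5.
(* The encoder depends on [M] and [goal] but not on [p]: the TBox code reaches it as input, which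
   avoids circularity. *)
pose c := encodep M.*2.*2 (encoding M goal); pose p := diagp c d.
have p_M : all (uses_below M) p.
  apply: uses_below_diagp M_gt5 _.
  by apply: sub_all d_b => -[r|r l] /= lt_r; rewrite /M leq_max lt_r.
pose T := rules_tbox (rules p M) ++ final (stateV (size p)).
(* The diagonal input: [p] runs on the code of the TBox that simulates [p]. *)
pose n := CodeSeq.code (map code_inclusion T).
pose x := reduction p M goal (final (stateV (size p)))
  (conf_code M M.*2 (input_tokens n)).
have run_c : runs c (initregs n) (initregs (code_instance x)).
  by rewrite (@code_reduction p M goal _ n M_gt0 erefl); exact: runs_encodep.
have [dec1 dec0] := dec x (K_reduction _ _ _).
have not_ent : ~ entailed x.
  move=> ent; have div := diagp_diverges run_c (dec1 ent).
  exact: (diverges_not_entailed final_model p_M M_gt0 div) ent.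
have halt := diagp_halts run_c (dec0 not_ent).
exact: not_ent (halts_entailed final_goal p_M M_gt0 halt).
Qed.

Lemma local_rules rs : all local_concepts (rules_tbox rs).
Proof.
apply/allP => c /flatten_mapP[r _]; move: c; apply/allP.
by case: r => [[k C]|[[[[A B] A'] B'] C]].
Qed.

Lemma future_rules rs : all future_inclusion (rules_tbox rs).
Proof.
apply/allP => c /flatten_mapP[r _]; move: c; apply/allP.
by case: r => [[k C]|[[[[A B] A'] B'] C]].
Qed.

Theorem theorem9 :
  TAQA_undecidable TEL_instance /\
  TAQA_undecidable TEL_future_rigid_instance.
Proof.
split.
  apply: (@reduction_undecidable _ (conc goalV) (fun q =>
    [:: SubNext (conc q) 0%R (conc goalV); SubNext (conc goalV) (-1)%R (conc goalV)])).
  - by move=> p M t; rewrite /TEL_instance /= all_cat local_rules.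
  - move=> X q no_q no_g; split=> [|/model_conc[x _ /no_g]//].
    by split=> [i d /model_conc[x _ /no_q]//|];
      split=> // i d /model_conc[x _ /no_g].
  move=> I q x [sat_q [sat_g _]] /sat_q; rewrite /= addr0 /sat_cfact /=.
  (* The goal travels from time x back to time 0 one unit at a time. *)
  by elim: x => // x IHx /sat_g /=; rewrite -addn1 PoszD addrK.
apply: (@reduction_undecidable _ (Rigid 0) (fun q =>
  [:: SubNext (conc q) 0%R (Rigid 0)])).
- by move=> p M t; rewrite /TEL_future_rigid_instance /= all_cat future_rules.
(* [model] interprets rigid concept names as empty, so the query fails there. *)
- move=> X q no_q _; split=> [|[]].
  by split=> // i d /model_conc[x _ /no_q].
move=> I q x [sat_q _] /sat_q; exact: (cext_rigid _ _ _ _).1.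
Qed.
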